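(* Let $G$ be a regular product of its finite subgroups $A_i$, $i\in I$, where $I$ is an ordered set. For each $i\in I$ let $L_i$ be a fixed covering group of $A_i$, with an exact sequence $1\to M_i\to L_i\xrightarrow{\nu_i}A_i\to 1$ such that $M_i$ is a normal subgroup of $L_i$, $M_i\subseteq Z(L_i)\cap L_i'$ and $M_i\cong M(A_i)$. Let $A=\prod^{*}_{i\in I}A_i$ and $L=\prod^{*}_{i\in I}L_i$ be the free products, let $\nu:L\to A$ be the epimorphism induced by the $\nu_i$, let $\psi:A\to G$ be the natural epimorphism induced by the identity map on each $A_i$, and let $H=\ker\psi$. Put $$J=\nu^{-1}(H)\cap[L_i^L],\qquad N=\prod_{i,j\in I,\ i\ne j}[M_i,L_j]^L,\qquad M=\Big(\prod_{i\in I}M_i\Big)J,$$ and let $\bar L$ and $\bar M$ be the images of $L$ and $M$, respectively, under the natural homomorphism $L\to L/N[J,L]$. Then there is an exact sequence $$1\to\bar M\to\bar L\to G\to 1$$ such that $\bar M\subseteq Z(\bar L)\cap[\bar L,\bar L]$ and $\bar M\cong M(G)$. In particular, $\bar L$ is a covering group of $G$.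
   Context: $M(X)$ denotes the Schur multiplier of a group $X$, and $X'=[X,X]$. A covering group of $X$ is a group $X^*$ with a normal subgroup $B$ such that $X^*/B\cong X$, $B\subseteq Z(X^* )\cap[X^*,X^*]$ and $B\cong M(X)$. A group $G$ is the regular product of its subgroups $A_i$, $i\in I$ ($I$ an ordered set), if $G=\langle A_i: i\in I\rangle$ and $A_i\cap\widehat{A}_i=1$ for all $i\in I$, where $\widehat{A}_i=\prod_{j\in I,\,j\ne i}A_j^{G}$ and $A_j^G$ is the normal closure of $A_j$ in $G$. For a subgroup $K$ of $L$, $K^L$ denotes the normal closure of $K$ in $L$. $[L_i^L]$ denotes the cartesian subgroup of the free product $L$: the subgroup generated by the $[L_i,L_j]^L$ for $i\ne j$, equivalently the kernel of the natural epimorphism from $L$ onto the (restricted) direct product of the $L_i$. $N$ is the subgroup generated by all $[M_i,L_j]^L$ with $i\neq j$, and $M$ is the subgroup of $L$ generated by all the $M_i$ and $J$. *)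

(* Defs.v *)
From HB Require Import structures.
From mathcomp Require Import all_boot all_order generic_quotient.
From mathcomp Require Import boolp classical_sets functions cardinality.

Set Implicit Arguments.
Unset Strict Implicit.
Unset Printing Implicit Defensive.

Local Open Scope quotient_scope.
Local Open Scope classical_set_scope.
Local Open Scope group_scope.

(* Groups are MathComp's (possibly infinite) [groupType]s; subsets of groups
   are classical sets. *)

Section Subsets.
Variable G : groupType.
Implicit Types (S K : set G).

Definition is_subgroup K : Prop :=
  [/\ K 1, forall x y, K x -> K y -> K (x * y) & forall x, K x -> K x^-1].

Definition is_normal K : Prop :=
  is_subgroup K /\ forall x y, K x -> K (x ^ y).

Definition gen S : set G := smallest is_subgroup S.

Definition nclosure S : set G := smallest is_normal S.

Definition commutator S K : set G :=
  gen [set z | exists x y, [/\ S x, K y & z = [~ x, y]]].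

Definition derived : set G := commutator setT setT.

Definition center : set G := [set z | forall x, commute z x].

Definition set_mulg S K : set G :=
  [set z | exists x y, [/\ S x, K y & z = x * y]].

Lemma gen_subgroup S : is_subgroup (gen S).
Proof.
split=> [K [[K1 _ _] _]|x y Sx Sy K KS|x Sx K KS]; first exact: K1.
- by have [[_ KM _] _] := KS; apply: KM; [apply: Sx|apply: Sy].
- by have [[_ _ KV] _] := KS; exact/KV/(Sx K KS).
Qed.

Lemma sub_gen S : S `<=` gen S.
Proof. exact: sub_gen_smallest. Qed.

Lemma nclosure_normal S : is_normal (nclosure S).
Proof.
split=> [|x y Sx K KS]; last by have [[_ KJ] _] := KS; exact/KJ/(Sx K KS).
split=> [K [[[K1 _ _] _] _]|x y Sx Sy K KS|x Sx K KS]; first exact: K1.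
- by have [[[_ KM _] _] _] := KS; apply: KM; [apply: Sx|apply: Sy].
- by have [[[_ _ KV] _] _] := KS; exact/KV/(Sx K KS).
Qed.

Lemma conj_subgroup K y : is_subgroup K -> is_subgroup [set x | K (x ^ y)].
Proof.
case=> K1 KM KV; split=> [|x z|x] /=; rewrite ?conj1g ?conjMg ?conjVg //.
  exact: KM.
exact: KV.
Qed.

Lemma gen_normal S : (forall x y, S x -> gen S (x ^ y)) -> is_normal (gen S).
Proof.
move=> SJ; split; first exact: gen_subgroup.
move=> x y Sx; apply: (Sx [set x | gen S (x ^ y)]).
split=> [|z Sz]; last exact: SJ.
exact/conj_subgroup/gen_subgroup.
Qed.

Lemma gen_bigcup_normal (I : Type) (P : set I) (F : I -> set G) :
  (forall i, P i -> is_normal (F i)) -> is_normal (gen (\bigcup_(i in P) F i)).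
Proof.
move=> FN; apply: gen_normal => x y [i Pi Fx]; apply: sub_gen.
by exists i => //; case: (FN i Pi) => _; apply.
Qed.

Lemma commutatorT_normal S : is_normal (commutator S setT).
Proof.
apply: gen_normal => _ z [x [y [Sx _ ->]]].
have -> : [~ x, y] ^ z = [~ x, z]^-1 * [~ x, y * z].
  by rewrite /commg /conjg !invgM !invgK !mulgA !mulgK.
have [_ GM GV] := gen_subgroup [set w | exists u v,
  [/\ S u, [set: G] v & w = [~ u, v]]].
by apply: GM; first apply: GV; apply: sub_gen;
  [exists x, z|exists x, (y * z)].
Qed.

Lemma set_mulg_normal S K :
  is_normal S -> is_normal K -> is_normal (set_mulg S K).
Proof.
case=> [[S1 SM SV] SJ] [[K1 KM KV] KJ]; split; first split.
- by exists 1, 1; rewrite mulg1.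
- move=> _ _ [a [b [Sa Kb ->]]] [c [d [Sc Kd ->]]].
  exists (a * c), (b ^ c * d);
  split; [exact: SM|by apply: KM => //; apply: KJ|].
  by rewrite /conjg !mulgA mulgK.
- move=> _ [a [b [Sa Kb ->]]]; exists a^-1, (b^-1 ^ a^-1).
  split; [exact: SV|by apply/KJ/KV|].
  by rewrite invgM /conjg invgK !mulgA mulVg mul1g.
- move=> _ y [a [b [Sa Kb ->]]]; exists (a ^ y), (b ^ y).
  by split; [exact: SJ|exact: KJ|rewrite conjMg].
Qed.

End Subsets.

Arguments derived : clear implicits.
Arguments center : clear implicits.

Definition kernel (G H : groupType) (f : G -> H) : set G := f @^-1` [set 1].

Definition isog (G H : groupType) (K : set G) (K' : set H) : Prop :=
  exists f : G -> H, set_bij K K' f /\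
    forall x y, K x -> K y -> f (x * y) = f x * f y.

(* Exactness of 1 -> K -> X -> Y -> 1, with K a subset of X and K -> X the
   inclusion; that K is then a normal subgroup is a consequence. *)
Definition exact_sequence (X Y : groupType) (K : set X)
    (f : {multiplicative X -> Y}) : Prop :=
  kernel f = K /\ range f = setT.

Section SubgroupType.
Variable G : groupType.

Structure subgroup := Subgroup {
  subgroup_set :> set G;
  subgroupP : is_subgroup subgroup_set
}.

Definition subgroup_type (K : subgroup) : Type :=
  {x : G | x \in subgroup_set K}.

Section Instances.
Variable K : subgroup.
HB.instance Definition _ := [isSub of subgroup_type K for @sval _ _].
HB.instance Definition _ := [Choice of subgroup_type K by <:].

Lemma subgroup_group_closed :
  group_closed [pred x : G | x \in subgroup_set K].
Proof.
have [K1 KM KV] := subgroupP K; split; first by rewrite !inE.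
by move=> x y; rewrite !inE => Kx Ky; apply: KM => //; apply: KV.
Qed.

HB.instance Definition _ := SubChoice_isSubGroup.Build G
  [pred x : G | x \in subgroup_set K] (subgroup_type K) subgroup_group_closed.
End Instances.
End SubgroupType.

Definition subgroup_incl (G : groupType) (K : subgroup G) :
    {multiplicative subgroup_type K -> G} :=
  (val : subgroup_type K -> G).

Section Quotient.
Variable G : groupType.

Structure normal_subgroup := NormalSubgroup {
  normal_set :> set G;
  normal_setP : is_normal normal_set
}.

Variable K : normal_subgroup.

Definition coset_rel : rel G := fun x y => `[< normal_set K (x^-1 * y) >].

Lemma coset_rel_equiv : equiv_class_of coset_rel.
Proof.
have [[K1 KM KV] _] := normal_setP K; split.
- by move=> x; apply/asboolP; rewrite mulVg.
- by move=> x y; apply/asboolP/asboolP => /KV; rewrite invgM invgK.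
- move=> y x z /asboolP xy /asboolP yz; apply/asboolP.
  by have := KM _ _ xy yz; rewrite mulgA mulgK.
Qed.

Canonical coset_equiv_rel := EquivRelPack coset_rel_equiv.

Definition quotient := {eq_quot coset_equiv_rel}.
HB.instance Definition _ := Choice.on quotient.
HB.instance Definition _ := EqQuotient.on quotient.

Definition coset (x : G) : quotient := \pi_quotient x.

Lemma cosetP x y : coset x = coset y <-> normal_set K (x^-1 * y).
Proof.
split=> [/eqquotP/asboolP //|Kxy]; exact/eqquotP/asboolP.
Qed.

Lemma coset_repr (q : quotient) : coset (repr q) = q.
Proof. exact: reprK. Qed.

Definition quotient_mul (p q : quotient) := coset (repr p * repr q).
Definition quotient_inv (p : quotient) := coset (repr p)^-1.

Lemma coset_mul x y : quotient_mul (coset x) (coset y) = coset (x * y).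
Proof.
have [[K1 KM KV] KJ] := normal_setP K.
apply/cosetP; set x' := repr _; set y' := repr _.
have /cosetP kx : coset x' = coset x by rewrite coset_repr.
have /cosetP ky : coset y' = coset y by rewrite coset_repr.
have -> : (x' * y')^-1 * (x * y) = (x'^-1 * x) ^ y' * (y'^-1 * y).
  by rewrite /conjg invgM !mulgA mulgK.
by apply: KM => //; apply: KJ.
Qed.

Lemma coset_inv x : quotient_inv (coset x) = coset x^-1.
Proof.
have [[K1 KM KV] KJ] := normal_setP K.
apply/cosetP; set x' := repr _.
have /cosetP kx : coset x' = coset x by rewrite coset_repr.
have := KV _ (KJ _ x'^-1 kx).
by rewrite /conjg invgK !mulgA mulgV mul1g invgF.
Qed.

Lemma quotient_mulA : associative quotient_mul.
Proof.
move=> p q r; rewrite -(coset_repr p) -(coset_repr q) -(coset_repr r).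
by rewrite !coset_mul mulgA.
Qed.

Lemma quotient_mul1 : left_id (coset 1) quotient_mul.
Proof. by move=> p; rewrite -(coset_repr p) coset_mul mul1g. Qed.

Lemma quotient_mulr1 : right_id (coset 1) quotient_mul.
Proof. by move=> p; rewrite -(coset_repr p) coset_mul mulg1. Qed.

Lemma quotient_mulV : left_inverse (coset 1) quotient_inv quotient_mul.
Proof. by move=> p; rewrite -(coset_repr p) coset_inv coset_mul mulVg. Qed.

Lemma quotient_mulrV : right_inverse (coset 1) quotient_inv quotient_mul.
Proof. by move=> p; rewrite -(coset_repr p) coset_inv coset_mul mulgV. Qed.

HB.instance Definition _ := isGroup.Build quotient quotient_mulA
  quotient_mul1 quotient_mulr1 quotient_mulV quotient_mulrV.

Lemma cosetM : {morph coset : x y / x * y}.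
Proof. by move=> x y; rewrite -coset_mul. Qed.

HB.instance Definition _ := isMultiplicative.Build G quotient coset cosetM.

End Quotient.

Definition nclosureN (G : groupType) (S : set G) : normal_subgroup G :=
  NormalSubgroup (nclosure_normal S).

(* [S, G] *)
Definition commutatorTN (G : groupType) (S : set G) : normal_subgroup G :=
  NormalSubgroup (commutatorT_normal S).

Definition mulN (G : groupType) (K K' : normal_subgroup G) :
    normal_subgroup G :=
  NormalSubgroup (set_mulg_normal (normal_setP K) (normal_setP K')).

Section FreeGroup.
Variable T : choiceType.

(* The letter (t, b) stands for t if b is false, and for t^-1 if b is true. *)
Definition word : Type := seq (T * bool).

Inductive free_congr : word -> word -> Prop :=
| FreeRefl w : free_congr w w
| FreeSym w w' : free_congr w w' -> free_congr w' w
| FreeTrans w w' w'' :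
    free_congr w w' -> free_congr w' w'' -> free_congr w w''
| FreeCancel u v t b :
    free_congr (u ++ [:: (t, b); (t, ~~ b)] ++ v) (u ++ v).

Definition free_rel : rel (seq (T * bool)) :=
  fun w w' => `[< free_congr w w' >].

Lemma free_rel_equiv : equiv_class_of free_rel.
Proof.
split.
- by move=> w; apply/asboolP; exact: FreeRefl.
- by move=> w w'; apply/asboolP/asboolP; exact: FreeSym.
- by move=> w w' w'' /asboolP ww /asboolP ww'; apply/asboolP/(FreeTrans ww ww').
Qed.

Canonical free_equiv_rel := EquivRelPack free_rel_equiv.

Definition free_group := {eq_quot free_equiv_rel}.
HB.instance Definition _ := Choice.on free_group.
HB.instance Definition _ := EqQuotient.on free_group.

Definition free_class (w : word) : free_group := \pi_free_group w.

Lemma free_classP w w' : free_class w = free_class w' <-> free_congr w w'.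
Proof. by split=> [/eqquotP/asboolP //|ww]; exact/eqquotP/asboolP. Qed.

Lemma free_class_repr (x : free_group) : free_class (repr x) = x.
Proof. exact: reprK. Qed.

Definition word_inv (w : word) : word := rev [seq (p.1, ~~ p.2) | p <- w].

Definition free_mul (x y : free_group) := free_class (repr x ++ repr y).
Definition free_one := free_class [::].
Definition free_inv (x : free_group) := free_class (word_inv (repr x)).

Lemma free_congr_ctx a b w w' :
  free_congr w w' -> free_congr (a ++ w ++ b) (a ++ w' ++ b).
Proof.
elim=> [v|v v' _|v v' v'' _ H1 _|u v t c];
  [exact: FreeRefl|exact: FreeSym|exact: FreeTrans|].
have := FreeCancel (a ++ u) (v ++ b) t c.
by rewrite -!catA.
Qed.

Lemma free_class_mul w w' :
  free_mul (free_class w) (free_class w') = free_class (w ++ w').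
Proof.
apply/free_classP; apply: (@FreeTrans _ (w ++ repr (free_class w'))).
  apply: (@free_congr_ctx [::]); apply/free_classP; exact: free_class_repr.
rewrite -[_ ++ repr _]cats0 -[w ++ w']cats0 -!catA.
by apply: free_congr_ctx; apply/free_classP; exact: free_class_repr.
Qed.

Lemma word_invK : involutive word_inv.
Proof.
move=> w; rewrite /word_inv map_rev revK -map_comp -[RHS]map_id.
by apply: eq_map => -[t b] /=; rewrite negbK.
Qed.

Lemma word_mulV w : free_congr (w ++ word_inv w) [::].
Proof.
elim: w => [|[t b] w IH]; first exact: FreeRefl.
rewrite /word_inv /= rev_cons -/(word_inv w) -cats1 catA.
apply: FreeTrans (FreeCancel [::] [::] t b).
exact: (free_congr_ctx [:: (t, b)] [:: (t, ~~ b)] IH).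
Qed.

Lemma free_mulA : associative free_mul.
Proof.
move=> x y z; rewrite -(free_class_repr x) -(free_class_repr y).
by rewrite -(free_class_repr z) !free_class_mul catA.
Qed.

Lemma free_mul1 : left_id free_one free_mul.
Proof. by move=> x; rewrite -(free_class_repr x) free_class_mul. Qed.

Lemma free_mulr1 : right_id free_one free_mul.
Proof. by move=> x; rewrite -(free_class_repr x) free_class_mul cats0. Qed.

Lemma free_mulV : left_inverse free_one free_inv free_mul.
Proof.
move=> x; rewrite -{2}(free_class_repr x) free_class_mul.
by apply/free_classP; rewrite -{2}[repr x]word_invK; exact: word_mulV.
Qed.

Lemma free_mulrV : right_inverse free_one free_inv free_mul.
Proof.
move=> x; rewrite -{1}(free_class_repr x) free_class_mul.
by apply/free_classP; exact: word_mulV.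
Qed.

HB.instance Definition _ := isGroup.Build free_group free_mulA
  free_mul1 free_mulr1 free_mulV free_mulrV.

Definition free_gen (t : T) : free_group := free_class [:: (t, false)].

Section Lift.
Variables (H : groupType) (f : T -> H).

Definition word_eval (w : word) : H :=
  \prod_(p <- w) (if p.2 then (f p.1)^-1 else f p.1).

Definition free_lift (x : free_group) : H := word_eval (repr x).

Lemma word_eval_congr w w' : free_congr w w' -> word_eval w = word_eval w'.
Proof.
elim=> [//|v v' _ -> //|v v' v'' _ -> _ -> //|u v t b].
rewrite /word_eval !big_cat !big_cons big_nil /= mulg1.
by case: b => /=; rewrite ?mulVg ?mulgV mul1g.
Qed.

Lemma free_lift_class w : free_lift (free_class w) = word_eval w.
Proof. by apply/word_eval_congr/free_classP; exact: free_class_repr. Qed.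

Lemma free_liftM : {morph free_lift : x y / x * y}.
Proof.
move=> x y; rewrite -(free_class_repr x) -(free_class_repr y).
rewrite [_ * _]free_class_mul !free_lift_class.
exact: big_cat.
Qed.

HB.instance Definition _ :=
  isMultiplicative.Build free_group H free_lift free_liftM.

Lemma free_lift_gen t : free_lift (free_gen t) = f t.
Proof. by rewrite free_lift_class /word_eval big_seq1. Qed.

End Lift.
End FreeGroup.

Section FreeProduct.
Variables (I : choiceType) (L : I -> groupType).

Definition letter : Type := {i : I & L i}.
HB.instance Definition _ := Choice.on letter.

Definition free_prod_letter (i : I) (x : L i) : free_group letter :=
  free_gen (Tagged L x : letter).

Definition free_prod_relators : set (free_group letter) :=
  [set z | exists (i : I) (x y : L i),
    z = free_prod_letter x * free_prod_letter y *
        (free_prod_letter (x * y))^-1].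

Definition free_prod := quotient (nclosureN free_prod_relators).
HB.instance Definition _ := Group.on free_prod.

Definition free_prod_in (i : I) (x : L i) : free_prod :=
  coset (nclosureN free_prod_relators) (free_prod_letter x).

Lemma free_prod_inM i : {morph @free_prod_in i : x y / x * y}.
Proof.
move=> x y; rewrite -[RHS]cosetM; apply/esym/cosetP.
have [[_ KM KV] KJ] := nclosure_normal free_prod_relators.
pose g := free_prod_letter x * free_prod_letter y.
have Kz : nclosure free_prod_relators (g * (free_prod_letter (x * y))^-1).
  by apply: sub_gen_smallest; exists i, x, y.
have := KV _ (KJ _ g Kz).
by rewrite /conjg mulgA mulKg invgM invgK.
Qed.

HB.instance Definition _ i :=
  isMultiplicative.Build (L i) free_prod (@free_prod_in i) (@free_prod_inM i).

Section Lift.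
Variables (H : groupType) (f : forall i, {multiplicative L i -> H}).

Definition free_prod_lift (x : free_prod) : H :=
  free_lift (fun p : letter => f (tag p) (tagged p)) (repr x).

Let F := free_lift (fun p : letter => f (tag p) (tagged p)).

Lemma free_prod_lift_coset z :
  free_prod_lift (coset (nclosureN free_prod_relators) z) = F z.
Proof.
have FM x y : F (x * y) = F x * F y by exact: free_liftM.
have F1 : F 1 = 1 by apply: (mulgI (F 1)); rewrite -FM !mulg1.
have FV x : F x^-1 = (F x)^-1.
  by apply: (mulgI (F x)); rewrite -FM !mulgV.
have Fker : is_normal (kernel F).
  split; first split; rewrite /kernel //=.
  - by move=> x y Fx Fy; rewrite FM Fx Fy mulg1.
  - by move=> x Fx; rewrite FV Fx invg1.
  - by move=> x y Fx; rewrite /conjg !FM FV Fx mul1g mulVg.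
have Frel : free_prod_relators `<=` kernel F.
  move=> _ [i [x [y ->]]]; rewrite /kernel /= !FM FV.
  by rewrite /F !free_lift_gen /= gmulfM mulgV.
rewrite /free_prod_lift -/F; set z' := repr _.
have /cosetP Kz : coset (nclosureN free_prod_relators) z' = coset _ z.
  exact: coset_repr.
have : F (z'^-1 * z) = 1 by apply: (Kz (kernel F)).
by rewrite FM FV => H1; rewrite -[LHS]mulg1 -H1 mulVKg.
Qed.

Lemma free_prod_liftM : {morph free_prod_lift : x y / x * y}.
Proof.
move=> x y; rewrite -(coset_repr x) -(coset_repr y).
by rewrite -[_ * _]cosetM !free_prod_lift_coset /F gmulfM.
Qed.

HB.instance Definition _ :=
  isMultiplicative.Build free_prod H free_prod_lift free_prod_liftM.

Lemma free_prod_lift_in i (x : L i) : free_prod_lift (free_prod_in x) = f i x.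
Proof. by rewrite free_prod_lift_coset /F free_lift_gen. Qed.

End Lift.
End FreeProduct.

Arguments free_prod_in {I L} i x.

Definition free_prod_map (I : choiceType) (L A : I -> groupType)
    (nu : forall i, {multiplicative L i -> A i}) : free_prod L -> free_prod A :=
  free_prod_lift (fun i => @free_prod_in I A i \o nu i).

HB.instance Definition _ (I : choiceType) (L A : I -> groupType)
    (nu : forall i, {multiplicative L i -> A i}) :=
  Multiplicative.on (free_prod_map nu).

(* The Schur multiplier of an arbitrary group X, as the Schur-Hopf quotient
   (R /\ [F, F]) / [R, F], viewed as a subset of F / [R, F], for the canonical
   free presentation 1 -> R -> F -> X -> 1 with F free on the underlying set
   of X.  Up to isomorphism it does not depend on the presentation. *)
Section SchurMultiplier.
Variable X : groupType.

Definition presentation : free_group X -> X := free_lift id.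
HB.instance Definition _ := Multiplicative.on presentation.

Definition schur_multiplier :
    set (quotient (commutatorTN (kernel presentation))) :=
  coset _ @` (kernel presentation `&` derived (free_group X)).
End SchurMultiplier.

Arguments schur_multiplier : clear implicits.

Definition is_covering_group (Y X : groupType) : Prop :=
  exists B : normal_subgroup Y,
    [/\ isog [set: quotient B] [set: X],
        B `<=` center Y `&` derived Y
      & isog B (schur_multiplier X)].

Definition regular_product (I : choiceType) (G : groupType)
    (A : I -> subgroup G) : Prop :=
  gen (\bigcup_i A i) = setT /\
  forall i, A i `&` gen (\bigcup_(j in [set j | j != i]) nclosure (A j))
            = [set 1].

(* The subgroup of the free product generated by all [M_i, L_j]^L, i != j. *)
Section CrossCommutators.
Variables (I : choiceType) (L : I -> groupType) (M : forall i, set (L i)).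

Definition cross_commutators : set (free_prod L) :=
  gen (\bigcup_(p in [set p : I * I | p.1 != p.2])
    nclosure (commutator (free_prod_in p.1 @` @M p.1)
                         (range (free_prod_in (L := L) p.2)))).

Lemma cross_commutators_normal : is_normal cross_commutators.
Proof.
by apply: gen_bigcup_normal => p _; exact: nclosure_normal.
Qed.

Definition cross_commutatorsN : normal_subgroup (free_prod L) :=
  NormalSubgroup cross_commutators_normal.
End CrossCommutators.

Definition cartesian_subgroup (I : choiceType) (L : I -> groupType) :
    set (free_prod L) :=
  cross_commutators (fun i => [set: L i]).

Arguments cartesian_subgroup {I} L.

(* Main.v *)
Require Import Defs.
From HB Require Import structures.
From mathcomp Require Import all_boot all_order.
From mathcomp Require Import boolp classical_sets functions cardinality.

(**
  Let F_i be the free group on the set A_i and R_i the kernel of F_i -> A_i.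
  The map F_i -> A_i lifts to F_i -> L_i, which is onto because M_i is central
  and contained in L_i', and which induces an epimorphism from
  M(A_i) = (R_i /\ F_i') / [R_i, F_i] onto M_i.  By Schur's theorem M(A_i) is
  finite, so M_i ~ M(A_i) makes this epimorphism injective: the kernel T_i of
  F_i -> L_i satisfies T_i /\ F_i' <= [R_i, F_i].

  The free product P of the F_i is a free group mapping onto
  L -> L/N[J,L] -> G; let R be the kernel of P -> G.  An element y of P' that
  dies in L/N[J,L] lies in [R, P]T, with T generated by the T_i: the map
  P -> P/[R, P]T factors through L, and the induced map on L kills N and [J, L]
  because it makes the kernel of L -> G central.  Modulo [R, P] the T_i are
  central, so y is congruent to a product of its components in the F_i, which
  lie in T_i /\ F_i' <= [R_i, F_i]; hence y is in [R, P].  So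
  M(G) = (R /\ P') / [R, P] embeds in L/N[J,L].

  Regularity is used for the kernel of L -> G: G / <A_j^G, j != i> is a copy of
  A_i, so the components of an element of this kernel lie in the M_i, and
  dividing by their product leaves an element of J.
*)

Set Implicit Arguments.
Unset Strict Implicit.
Unset Printing Implicit Defensive.

Local Open Scope classical_set_scope.
Local Open Scope group_scope.

(** * Subgroups, commutators and the center *)

Section Subgroups.
Variable G : groupType.
Implicit Types S K : set G.

Lemma gen_min S K : is_subgroup K -> S `<=` K -> gen S `<=` K.
Proof. by move=> sgK SK x; apply. Qed.

Lemma nclosure_min S K : is_normal K -> S `<=` K -> nclosure S `<=` K.
Proof. by move=> nK SK x; apply. Qed.

Lemma sub_nclosure S : S `<=` nclosure S.
Proof. exact: sub_gen_smallest. Qed.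

Lemma commutator_comm S K x y : S x -> K y -> commutator S K [~ x, y].
Proof. by move=> Sx Ky; apply: sub_gen; exists x, y. Qed.

Lemma derived_subgroup : is_subgroup (derived G).
Proof. exact: gen_subgroup. Qed.

Lemma center_subgroup : is_subgroup (center G).
Proof.
split=> [y|x y Zx Zy z|x Zx y]; first exact/commute_sym/commute1.
- by apply/commute_sym/commuteM; apply/commute_sym.
- exact/commute_sym/commuteV/commute_sym.
Qed.

Lemma center_fix_normal K : is_subgroup K -> K `<=` center G -> is_normal K.
Proof.
move=> sgK KZ; split=> // x y Kx.
by have -> : x ^ y = x by apply/conjg_fixP/commgP/KZ.
Qed.
End Subgroups.

(** * Homomorphisms and quotients *)

Section Morphisms.
Variables (G H : groupType) (f : {multiplicative G -> H}).

(* MathComp's [gmulf] lemmas on 1, inverses, etc. ask for a bundled proof of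
   [f 1 = 1], which [{multiplicative G -> H}] does not carry. *)
Lemma mulf_1 : f 1 = 1.
Proof. by apply: (mulgI (f 1)); rewrite -gmulfM !mulg1. Qed.

Lemma mulf_V : {morph f : x / x^-1}.
Proof. by move=> x; apply: (mulgI (f x)); rewrite -gmulfM !mulgV mulf_1. Qed.

Lemma mulf_J : {morph f : x y / x ^ y}.
Proof. by move=> x y; rewrite !gmulfM mulf_V. Qed.

Lemma mulf_R : {morph f : x y / [~ x, y]}.
Proof. by move=> x y; rewrite gmulfM mulf_J mulf_V. Qed.

Lemma mulf_X n : {morph f : x / x ^+ n}.
Proof.
by move=> x; elim: n => [|n IH]; rewrite ?mulf_1 // !expgS gmulfM IH.
Qed.

Lemma mulf_prod (I : Type) (r : seq I) (F : I -> G) :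
  f (\prod_(i <- r) F i) = \prod_(i <- r) f (F i).
Proof. exact: (big_morph f (@gmulfM _ _ f) mulf_1). Qed.

Lemma preim_subgroup (K : set H) : is_subgroup K -> is_subgroup (f @^-1` K).
Proof.
case=> K1 KM KV; split=> [|x y|x] /=; rewrite ?mulf_1 ?gmulfM ?mulf_V //.
  exact: KM.
exact: KV.
Qed.

Lemma preim_normal (K : set H) : is_normal K -> is_normal (f @^-1` K).
Proof.
case=> sgK KJ; split; first exact: preim_subgroup.
by move=> x y /=; rewrite mulf_J; apply: KJ.
Qed.

Lemma set1_normal : is_normal [set (1 : H)].
Proof.
split; first split=> //= [x y -> ->|x ->]; rewrite ?mulg1 ?invg1 //.
by move=> x y ->; rewrite conj1g.
Qed.

Lemma kernel_normal : is_normal (kernel f).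
Proof. exact/preim_normal/set1_normal. Qed.

Lemma image_gen (S : set G) (K : set H) :
  is_subgroup K -> (forall x, S x -> K (f x)) -> forall x, gen S x -> K (f x).
Proof. by move=> sgK SK; apply: gen_min => //; exact: preim_subgroup. Qed.

Lemma image_derived x : derived G x -> derived H (f x).
Proof.
move: x; apply: image_gen; first exact: derived_subgroup.
by move=> _ [x [y [_ _ ->]]]; rewrite mulf_R; apply: commutator_comm.
Qed.

Lemma image_subgroup (K : set G) : is_subgroup K -> is_subgroup (f @` K).
Proof.
case=> K1 KM KV; split; first by exists 1; rewrite ?mulf_1.
- move=> _ _ [x Kx <-] [y Ky <-]; exists (x * y); rewrite ?gmulfM //.
  exact: KM.
- by move=> _ [x Kx <-]; exists x^-1; rewrite ?mulf_V //; apply: KV.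
Qed.

Section QuotientLift.
Variable K : normal_subgroup G.

(** The proof [fK] is carried in the term so that the multiplicative structure can be inferred from
    it. *)
Definition quotient_lift (fK : K `<=` kernel f) (q : quotient K) : H :=
  f (repr q).

Variable fK : K `<=` kernel f.

Lemma quotient_lift_coset x : quotient_lift fK (coset K x) = f x.
Proof.
have /cosetP/fK : coset K (repr (coset K x)) = coset K x by exact: coset_repr.
by rewrite /kernel /= gmulfM mulf_V => /eqP; rewrite mulg_eq1 eqg_inv => /eqP.
Qed.

Lemma quotient_liftM : {morph quotient_lift fK : x y / x * y}.
Proof.
move=> p q; rewrite -(coset_repr p) -(coset_repr q) -cosetM.
by rewrite !quotient_lift_coset gmulfM.
Qed.

HB.instance Definition _ :=
  isMultiplicative.Build (quotient K) H (quotient_lift fK) quotient_liftM.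
End QuotientLift.
End Morphisms.
Arguments quotient_lift {G H f K} fK q : simpl never.

Lemma coset_eq1 (G : groupType) (K : normal_subgroup G) x :
  coset K x = 1 <-> normal_set K x.
Proof.
have [[_ _ KV] _] := normal_setP K.
split=> [/esym|Kx]; last by apply/esym/cosetP; rewrite invg1 mul1g.
by move=> /cosetP; rewrite invg1 mul1g.
Qed.

Lemma equalizer_subgroup (G H : groupType) (f g : {multiplicative G -> H}) :
  is_subgroup [set x | f x = g x].
Proof.
split=> [|x y /= xE yE|x /= xE]; first by rewrite /= !mulf_1.
  by rewrite !gmulfM xE yE.
by rewrite !mulf_V xE.
Qed.

Lemma isog_sym (G H : groupType) (K : set G) (K' : set H) :
  is_subgroup K -> isog K K' -> isog K' K.
Proof.
case=> K1 KM _ [f [[fK finj fsurj] fM]].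
(* Maps in [isog] are total, so the inverse needs an arbitrary value, here 1, off [K']. *)
have /choice[g gP] y : exists x, K' y -> K x /\ f x = y.
  have [/fsurj[x Kx <-]|nK'] := pselect (K' y); first by exists x.
  by exists 1.
exists g; split; first split.
- by move=> y /gP[].
- move=> x y /set_mem/gP[_ {2}<-] /set_mem/gP[_ {2}<-].
  by move=> ->.
- move=> x Kx; exists (f x); first exact: fK.
  have [Kgx fgx] := gP _ (fK _ Kx).
  by apply: finj; rewrite ?inE.
- move=> x y Kx Ky; have [Kgx fgx] := gP _ Kx; have [Kgy fgy] := gP _ Ky.
  have Kxy : K' (x * y) by rewrite -fgx -fgy -fM //; apply/fK/KM.
  have [Kgxy fgxy] := gP _ Kxy.
  apply: finj; rewrite ?inE //; first exact: KM.
  by rewrite fM // fgxy fgx fgy.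
Qed.

(** * Schur's theorem on central extensions of finite groups *)

(** Among the powers of [x] with exponents 0 to [size s] two coincide, so [x] is killed by some
    positive exponent at most [size s], which divides the factorial. *)
Lemma finite_exponent (X : groupType) : finite_set [set: X] ->
  exists2 k, (0 < k)%N & forall x : X, x ^+ k = 1.
Proof.
move=> /finite_seqP[s Xs]; exists (size s)`!; first exact: fact_gt0.
move=> x; pose t := [seq x ^+ i | i <- iota 0 (size s).+1].
have : ~~ uniq t.
  apply/negP => /(@uniq_leq_size _ t s) ts.
  suff /ts : {subset t <= s} by rewrite size_map size_iota ltnn.
  by move=> y _; have : [set: X] y by []; rewrite Xs.
move=> /(uniqPn 1)[i [j [ij]]]; rewrite size_map size_iota => js.
have is_ := ltn_trans ij js.
rewrite !(nth_map 0) ?size_iota // !nth_iota // !add0n => xij.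
have /dvdnP[m ->] : j - i %| (size s)`!.
  by rewrite dvdn_fact // subn_gt0 ij leq_subLR (leq_trans _ (leq_addl _ _)).
rewrite mulnC expgnA (_ : x ^+ (j - i) = 1) ?expg1n //.
by rewrite expgnFr ?(ltnW ij) // -xij mulgV.
Qed.

(* Schur's theorem, by Rosenlicht's argument: a long product of commutators
   contains some commutator [c] more than [k] times, and [c ^+ k.+1] is a
   product of [k] commutators as soon as [c ^+ k] is central. *)
Section Schur.
Variable E : groupType.

(** Put c = [~ a, b]. Centrality gives c^(k+1) = (c^b)^(k+1), so c^(k+2) is c c^b times (c^b)^k,
    where c c^b = [~ a, b^2] and c^b = [~ a^b, b]. Thus k+2 commutators become k+1. *)
Lemma commg_expS (a b : E) k : (forall x, commute ([~ a, b] ^+ k.+1) x) ->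
  [~ a, b] ^+ k.+2 = [~ a, b ^+ 2] * [~ a ^ b, b] ^+ k.
Proof.
move=> Zc; set c := [~ a, b] in Zc *.
have cb : c ^+ k.+1 = (c ^ b) ^+ k.+1.
  by rewrite -conjXg; apply/esym/conjg_fixP/commgP.
have -> : [~ a ^ b, b] = c ^ b by rewrite conjRg [b ^ b]conjgE mulKg.
have -> : [~ a, b ^+ 2] = c * c ^ b.
  by rewrite /c /commg /conjg expg2 !invgM !mulgA !mulgK.
by rewrite expgS cb expgS mulgA.
Qed.

Definition is_commutator (z : E) := exists x y, z = [~ x, y].

Lemma derived_prod z : derived E z ->
  exists2 w, {in w, forall c, is_commutator c} & z = \prod_(c <- w) c.
Proof.
move: z; apply: gen_min.
  split=> [|_ _ [u Cu ->] [v Cv ->]|_ [u Cu ->]].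
  - by exists [::] => //; rewrite big_nil.
  - exists (u ++ v); last by rewrite big_cat.
    by move=> c; rewrite mem_cat => /orP[/Cu|/Cv].
  - exists (rev [seq c^-1 | c <- u]).
      move=> c; rewrite mem_rev => /mapP[d /Cu[x [y ->]] ->].
      by exists y, x; rewrite invgR.
    by rewrite -map_rev big_map prodgV revK.
move=> _ [x [y [_ _ ->]]]; exists [:: [~ x, y]]; last by rewrite big_seq1.
by move=> c; rewrite inE => /eqP ->; exists x, y.
Qed.

Lemma is_commutatorJ c z : is_commutator c -> is_commutator (c ^ z).
Proof. by move=> [x [y ->]]; exists (x ^ z), (y ^ z); rewrite conjRg. Qed.

(** Commutators depend only on their arguments modulo the center. This bounds their number in
    [derived_finite] and lets them be lifted in [stem_derived]. *)
Lemma commg_mul_center (x y z t : E) : center E z -> center E t ->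
  [~ x * z, y * t] = [~ x, y].
Proof.
move=> Zz Zt; have Jz u : z ^ u = z by apply/conjg_fixP/commgP/Zz.
have Jt u : u ^ t = u by apply/conjg_fixP/commgP/commute_sym/Zt.
by rewrite commgEl conjMg Jz conjgM Jt -!Zz invgM -mulgA mulKg.
Qed.

(** Pigeonhole principle, by induction on [C]: filter out of [w] all copies of the head of [C]. *)
Lemma size_count_bound (T : eqType) (C w : seq T) m : {subset w <= C} ->
  (forall c, c \in C -> (count_mem c w <= m)%N) -> (size w <= size C * m)%N.
Proof.
elim: C w => [|c C IH] w wC wm /=.
  by case: w wC {wm} => // x w /(_ x); rewrite mem_head => /(_ isT).
rewrite -(count_predC (pred1 c) w) mulSn leq_add ?wm ?mem_head //.
rewrite -size_filter IH // => [x|d dC].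
  by rewrite mem_filter => /andP[/= xc /wC]; rewrite inE (negPf xc).
rewrite count_filter (leq_trans _ (wm d _)) ?inE ?dC ?orbT //.
by apply: sub_count => x /andP[].
Qed.

(** Since u c = c u^c, one copy of [c] moves to the front at the price of conjugating the letters
    before it. These remain commutators, and copies of [c] among them are fixed, so the count drops
    by exactly one. *)
Lemma prod_extract c n (w : seq E) : {in w, forall c, is_commutator c} ->
  (n <= count_mem c w)%N -> exists w', [/\ {in w', forall c, is_commutator c},
    size w = (n + size w')%N & \prod_(x <- w) x = c ^+ n * \prod_(x <- w') x].
Proof.
elim: n w => [|n IH] w Cw nw; first by exists w; split; rewrite ?expg0 ?mul1g.
have cw : c \in w by rewrite -has_pred1 has_count (leq_trans _ nw).
have [u [v Ew]] : exists u v, w = u ++ c :: v.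
  by have [u v] := splitPr cw; exists u, v.
pose w1 := [seq x ^ c | x <- u] ++ v.
have [||w' [Cw' sw' pw']] := IH w1.
- move=> x; rewrite mem_cat => /orP[/mapP[y yu ->]|xv].
    by apply/is_commutatorJ/Cw; rewrite Ew mem_cat yu.
  by apply: Cw; rewrite Ew mem_cat inE xv !orbT.
- move: nw; rewrite Ew !count_cat /= eqxx count_map.
  have cc : c ^ c = c by rewrite conjgE mulKg.
  rewrite -(@eq_count _ (preim (conjg^~ c) (pred1 c))) => [|x /=].
    by rewrite add1n addnS.
  by rewrite -{2}cc (inj_eq (@conjg_inj _ c)).
exists w'; split=> //.
  by rewrite addSn -sw' Ew !size_cat size_map /= addnS.
rewrite expgS -mulgA -pw' Ew !big_cat big_cons big_map /=.
by rewrite -conjg_prod mulgA [RHS]mulgA -conjgC.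
Qed.

Lemma derived_finite (X : groupType) (q : {multiplicative E -> X}) :
  kernel q `<=` center E -> range q = setT -> finite_set [set: X] ->
  finite_set (derived E).
Proof.
(* The exponent of [X] is written [k.+1]; every [k.+1]-th power in [E] then lies in the kernel of
   [q], hence in the center. *)
move=> qZ qsurj Xfin; have [[//|k] _ kX] := finite_exponent Xfin.
have /choice[s sK] x : exists e, q e = x.
  have : range q x by rewrite qsurj.
  by move=> [e _ <-]; exists e.
(* A commutator depends only on the images of its arguments in [X], so the finite list [C] contains
   all of them. *)
have /finite_seqP[C eC] : finite_set [set [~ s p.1, s p.2] | p in [set: X * X]].
  by apply: finite_image; rewrite -setXTT; apply: finite_setX.
have EC x : is_commutator x -> x \in C.
  move=> [a [b ->]]; have : [set` C] [~ s (q a), s (q b)].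
    by rewrite -eC; exists (q a, q b).
  have sZ y : center E (y^-1 * s (q y)).
    by apply: qZ; rewrite /kernel /= gmulfM mulf_V sK mulVg.
  rewrite /= -{1}(mulVKg a (s (q a))) -{1}(mulVKg b (s (q b))).
  by rewrite commg_mul_center.
have short (w : seq E) : {in w, forall c, is_commutator c} ->
    exists w', [/\ {in w', forall c, is_commutator c},
      (size w' <= size C * k.+1)%N & \prod_(x <- w) x = \prod_(x <- w') x].
  have [n] := ubnP (size w); elim: n w => // n IH w nw Cw.
  have [wC|Cw_lt] := leqP (size w) (size C * k.+1); first by exists w.
  have [c cw kc] : exists2 c, c \in w & (k.+1 < count_mem c w)%N.
    apply: contrapT => nc; move: Cw_lt; rewrite ltnNge size_count_bound //.
      by move=> c /Cw/EC.
    move=> c _; rewrite leqNgt; apply/negP => kc; apply: nc; exists c => //.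
    by rewrite -has_pred1 has_count (leq_trans _ kc).
  have [w1 [Cw1 sw1 ->]] := prod_extract Cw kc.
  have [a [b Ec]] := Cw _ cw.
  (* The [k.+2] extracted copies of [c] are replaced by [k.+1] commutators, so the word is one
     letter shorter and the induction applies. *)
  have [||w' [Cw' sw' pw']] :=
    IH ([:: [~ a, b ^+ 2] & nseq k [~ a ^ b, b]] ++ w1).
  - rewrite size_cat /= size_nseq -ltnS.
    by move: nw; rewrite sw1 !addSn.
  - move=> x; rewrite mem_cat => /orP[|/Cw1//]; rewrite inE => /orP[/eqP->|].
      by exists a, (b ^+ 2).
    by rewrite mem_nseq => /andP[_ /eqP->]; exists (a ^ b), b.
  exists w'; split=> //; rewrite -pw' big_cat big_cons big_nseq iter_mulg_1 Ec.
  rewrite commg_expS // => x; apply: qZ.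
  by rewrite /kernel /= mulf_X kX.
have fin n : finite_set [set z | exists w : seq E,
    [/\ {in w, forall c, is_commutator c}, (size w <= n)%N
      & z = \prod_(c <- w) c]].
  elim: n => [|n IH].
    apply: sub_finite_set (finite_set1 (1 : E)) => z [[|c w] [_ //= _ ->]].
    by rewrite big_nil.
  have Cfin : finite_set ([set 1] `|` [set` C]).
    by rewrite finite_setU; split; [exact: finite_set1|exact: finite_seq].
  apply: sub_finite_set (finite_image2 (fun x y => x * y) Cfin IH).
  move=> z [[|c w] [Cw sw ->]] /=.
    by exists 1; [left|exists 1; [exists [::]|]]; rewrite ?big_nil ?mulg1.
  exists c; first by right; apply/EC/Cw/mem_head.
  exists (\prod_(x <- w) x); last by rewrite big_cons.
  by exists w; split=> // x xw; apply: Cw; rewrite inE xw orbT.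
apply: sub_finite_set (fin (size C * k.+1)%N) => z /derived_prod[w /short].
by move=> [w' [Cw' sw' ->]] ->; exists w'.
Qed.
End Schur.

(** * Stem extensions *)

Lemma setI_subgroup (G : groupType) (K K' : set G) :
  is_subgroup K -> is_subgroup K' -> is_subgroup (K `&` K').
Proof.
move=> [K1 KM KV] [K'1 K'M K'V]; split=> // [x y [Kx K'x] [Ky K'y]|x [Kx K'x]].
  by split; [exact: KM|exact: K'M].
by split; [exact: KV|exact: K'V].
Qed.

Lemma commutator_kernel (P E : groupType) (g : {multiplicative P -> E})
    (R : set P) :
  (forall r, R r -> center E (g r)) -> commutator R setT `<=` kernel g.
Proof.
move=> Rg; apply: gen_min; first by case: (kernel_normal g).
move=> _ [r [y [Rr _ ->]]]; rewrite /kernel /= mulf_R.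
exact/eqP/commgP/Rg.
Qed.

Section StemExtension.
Variables (P E X : groupType) (f : {multiplicative E -> X}).
Variables (p : {multiplicative P -> X}) (g : {multiplicative P -> E}).
Hypotheses (fZ : kernel f `<=` center E) (fD : kernel f `<=` derived E).
Hypotheses (fg : forall x, f (g x) = p x) (p_surj : range p = setT).

Lemma stem_decomp e : exists x z, center E z /\ e = g x * z.
Proof.
have [x _ px] : range p (f e) by rewrite p_surj.
exists x, ((g x)^-1 * e); split; last by rewrite mulVKg.
by apply: fZ; rewrite /kernel /= gmulfM mulf_V fg px mulVg.
Qed.

(** E is g(P) times its center, so every commutator of E is already a commutator of elements of
    g(P). *)
Lemma stem_derived : derived E `<=` g @` derived P.
Proof.
apply: gen_min; first exact/image_subgroup/derived_subgroup.
move=> _ [a [b [_ _ ->]]].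
have [x [z [Zz ->]]] := stem_decomp a; have [y [t [Zt ->]]] := stem_decomp b.
rewrite commg_mul_center // -mulf_R; exists [~ x, y] => //.
exact: commutator_comm.
Qed.

Lemma stem_lift_kernel b : kernel f b ->
  exists x, [/\ kernel p x, derived P x & g x = b].
Proof.
move=> fb; have [x Dx gx] := stem_derived (fD fb).
by exists x; split=> //; rewrite /kernel /= -fg gx.
Qed.

(** The image of g covers E up to the kernel of f, and that kernel, lying in E', is itself contained
    in g(P'). *)
Lemma stem_lift_surj : range g = setT.
Proof.
apply/seteqP; split=> // e _; have [x [z [_ ->]]] := stem_decomp e.
have [y _ py] : range p (f z) by rewrite p_surj.
have [|t [_ _ gt]] := @stem_lift_kernel ((g y)^-1 * z).
  by rewrite /kernel /= gmulfM mulf_V fg py mulVg.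
by exists (x * (y * t)); rewrite // !gmulfM gt mulVKg.
Qed.

Lemma stem_commutator : commutator (kernel p) setT `<=` kernel g.
Proof.
by apply: commutator_kernel => r pr; apply: fZ; rewrite /kernel /= fg.
Qed.
End StemExtension.

(** * Comparing the kernel of a stem extension with the Schur multiplier *)

Section Multiplier.
Variables (E X : groupType) (f : {multiplicative E -> X}).
Variable g : {multiplicative free_group X -> E}.
Let R := kernel (@presentation X).
Hypotheses (fZ : kernel f `<=` center E) (fD : kernel f `<=` derived E).
Hypothesis fg : forall x, f (g x) = presentation x.

Lemma presentation_surj : range (@presentation X) = setT.
Proof.
apply/seteqP; split=> // x _; exists (free_gen x) => //.
by rewrite /presentation free_lift_gen.
Qed.

Let gR : commutatorTN R `<=` kernel g.
Proof. exact: stem_commutator fZ fg. Qed.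

Lemma schur_multiplier_subgroup : is_subgroup (schur_multiplier X).
Proof.
apply/image_subgroup/setI_subgroup; last exact: derived_subgroup.
by case: (kernel_normal (@presentation X)).
Qed.

Lemma schur_multiplier_lift q :
  schur_multiplier X q -> kernel f (quotient_lift gR q).
Proof.
by move=> [x [Rx _] <-]; rewrite /kernel /= quotient_lift_coset fg.
Qed.

Lemma schur_multiplier_lift_surj b : kernel f b ->
  exists2 q, schur_multiplier X q & quotient_lift gR q = b.
Proof.
move=> /(stem_lift_kernel fZ fD fg presentation_surj)[x [Rx Dx gx]].
by exists (coset _ x); [exists x|rewrite quotient_lift_coset].
Qed.

(** [quotient_lift gR] maps the multiplier onto the kernel of [f]; the premise says that only the
    trivial class dies. *)
Lemma isog_schur_multiplier :
  (forall x, R x -> derived _ x -> g x = 1 -> commutator R setT x) ->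
  isog (kernel f) (schur_multiplier X).
Proof.
move=> gI; apply: isog_sym; first exact: schur_multiplier_subgroup.
exists (quotient_lift gR); split; last by move=> x y _ _; exact: gmulfM.
split; first exact: schur_multiplier_lift; last first.
  by move=> b /schur_multiplier_lift_surj[q Sq <-]; exists q.
move=> _ _ /set_mem[x [Rx Dx] <-] /set_mem[y [Ry Dy] <-].
rewrite !quotient_lift_coset => gxy; apply/cosetP; apply: (gI (x^-1 * y)).
- have [[_ RM RV] _] := kernel_normal (@presentation X).
  by apply: RM => //; apply: RV.
- have [_ DM DV] := derived_subgroup (free_group X).
  by apply: DM => //; apply: DV.
- by rewrite gmulfM mulf_V gxy mulVg.
Qed.

Hypothesis X_finite : finite_set [set: X].

(** F/[R, F] is a central extension of the finite group X, so by Schur its derived subgroup, which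
    contains the multiplier, is finite. *)
Lemma schur_multiplier_finite : finite_set (schur_multiplier X).
Proof.
have RK : commutatorTN R `<=` kernel (@presentation X).
  apply: commutator_kernel => r Rr x; rewrite [X in commute X _]Rr.
  exact/commute_sym/commute1.
apply: (@sub_finite_set _ _ (derived (quotient (commutatorTN R)))).
  by move=> _ [x [_ Dx] <-]; exact: image_derived.
apply: (@derived_finite _ X (quotient_lift RK)) => //.
  move=> q; rewrite -(coset_repr q) /kernel /= quotient_lift_coset => Rq y.
  rewrite -(coset_repr y); apply/commgP/eqP; rewrite -mulf_R.
  by apply/coset_eq1; apply: commutator_comm.
rewrite -subTset => x _; exists (coset (commutatorTN R) (free_gen x)) => //=.
by rewrite quotient_lift_coset; exact: free_lift_gen.
Qed.

(** The given isomorphism [h] is abstract and unrelated to [g]. Still, [quotient_lift gR] followed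
    by [h] maps the finite multiplier onto itself, so it is injective there, and hence so is the
    lift. *)
Lemma stem_lift_inj : isog (kernel f) (schur_multiplier X) ->
  forall x, R x -> derived _ x -> g x = 1 -> commutator R setT x.
Proof.
move=> [h [[_ _ hsurj] _]] x Rx Dx gx.
have [s0 Es0] := (finite_seqP _).1 schur_multiplier_finite.
pose s := undup s0.
have sP q : (q \in s) <-> schur_multiplier X q by rewrite mem_undup Es0.
pose F q := h (quotient_lift gR q).
have S1 : schur_multiplier X 1 by case: schur_multiplier_subgroup.
have sF : {subset s <= map F s}.
  move=> q /sP/hsurj[b /schur_multiplier_lift_surj[q' /sP q's <-] <-].
  exact: map_f.
have uF : uniq (map F s).
  by apply: leq_size_uniq sF _; rewrite ?undup_uniq ?size_map.
have Finj : {in s &, injective F}.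
  move=> a b sa sb Fab; rewrite -(nth_index 1 sa) -(nth_index 1 sb); congr nth.
  apply/eqP; rewrite -(nth_uniq 1 _ _ uF) ?size_map ?index_mem //.
  by rewrite !(nth_map 1) ?index_mem // !nth_index // Fab.
apply/(coset_eq1 (commutatorTN R)); apply: Finj.
- by apply/sP; exists x.
- exact/sP.
- by rewrite /F quotient_lift_coset gx mulf_1.
Qed.
End Multiplier.

(** * Free products *)

Lemma free_group_ind (T : choiceType) (K : set (free_group T)) :
  is_subgroup K -> (forall t, K (free_gen t)) -> forall x, K x.
Proof.
move=> [K1 KM KV] Kt x; rewrite -(free_class_repr x).
elim: (repr x) => [|[t b] w IH]; first exact: K1.
rewrite -cat1s -free_class_mul; apply: KM => //.
case: b; last exact: Kt.
suff -> : free_class [:: (t, true)] = (free_gen t)^-1 by exact/KV/Kt.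
apply: (mulgI (free_gen t)); rewrite mulgV [LHS]free_class_mul.
exact/free_classP/(FreeCancel [::] [::] t false).
Qed.

Lemma free_group_ext (T : choiceType) (H : groupType)
    (f g : {multiplicative free_group T -> H}) :
  (forall t, f (free_gen t) = g (free_gen t)) -> f =1 g.
Proof.
move=> fg; apply: (@free_group_ind _ [set x | f x = g x]); last exact: fg.
exact: equalizer_subgroup.
Qed.

Section FreeProductTheory.
Variables (I : choiceType) (L : I -> groupType).

Lemma free_prod_ind (K : set (free_prod L)) :
  is_subgroup K -> (forall i x, K (free_prod_in i x)) -> forall z, K z.
Proof.
move=> sgK Kin z; rewrite -(coset_repr z).
pose c := coset (nclosureN (@free_prod_relators I L)).
move: (repr z); apply: (@free_group_ind _ (c @^-1` K)).
  exact: (preim_subgroup c sgK).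
by move=> [i x]; exact: Kin.
Qed.

Lemma free_prod_ext (H : groupType) (f g : {multiplicative free_prod L -> H}) :
  (forall i x, f (free_prod_in i x) = g (free_prod_in i x)) -> f =1 g.
Proof.
move=> fg; apply: (@free_prod_ind [set z | f z = g z]); last exact: fg.
exact: equalizer_subgroup.
Qed.

Section Projection.
Variable i : I.

(** [L j] and [L i] are distinct types until [j] is identified with [i], hence the transport along
    the decided equality. *)
Definition free_prod_comp j (x : L j) : L i :=
  if j =P i is ReflectT e then ecast k (L k) e x else 1.

Lemma free_prod_compM j : {morph @free_prod_comp j : x y / x * y}.
Proof.
rewrite /free_prod_comp => x y; case: eqP => [e|_]; last by rewrite mulg1.
by case: _ / e.
Qed.

HB.instance Definition _ j :=
  isMultiplicative.Build (L j) (L i) (@free_prod_comp j) (@free_prod_compM j).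

Lemma free_prod_comp_id x : @free_prod_comp i x = x.
Proof. by rewrite /free_prod_comp; case: eqP => // e; rewrite eq_axiomK. Qed.

Lemma free_prod_comp_neq j x : j != i -> @free_prod_comp j x = 1.
Proof. by rewrite /free_prod_comp; case: eqP. Qed.

Definition free_prod_proj : free_prod L -> L i :=
  free_prod_lift (fun j => @free_prod_comp j).

HB.instance Definition _ := Multiplicative.on free_prod_proj.

Lemma free_prod_proj_id x : free_prod_proj (free_prod_in i x) = x.
Proof. by rewrite /free_prod_proj free_prod_lift_in /= free_prod_comp_id. Qed.

Lemma free_prod_proj_neq j x :
  j != i -> free_prod_proj (free_prod_in j x) = 1.
Proof.
by move=> ji; rewrite /free_prod_proj free_prod_lift_in /= free_prod_comp_neq.
Qed.
End Projection.

Section ProductFormula.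
Variables (Q : groupType) (q : {multiplicative free_prod L -> Q}).
Variable S : forall i, set (L i).
Arguments S : clear implicits.
Hypothesis S_subgroup : forall i, is_subgroup (S i).
Hypothesis S_commute : forall i j x y, i != j -> S i x -> S j y ->
  commute (q (free_prod_in i x)) (q (free_prod_in j y)).

Let F z i := q (free_prod_in i (free_prod_proj i z)).

(** The formula passes to products and inverses because factors at distinct indices commute; this
    needs the components to lie in [S i], so both claims are proved together. Quantifying over all
    duplicate-free [s] containing a finite support lets two elements share one index list. *)
Lemma prod_free_prod_proj z : gen (\bigcup_i (free_prod_in i @` S i)) z ->
  (forall i, S i (free_prod_proj i z)) /\
  exists s0 : seq I, forall s : seq I, uniq s -> {subset s0 <= s} ->
    q z = \prod_(i <- s) F z i.
Proof.
have SE i : is_subgroup (S i) by [].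
move: z; apply: gen_min.
  split.
  - split=> [i|]; first by rewrite mulf_1; case: (SE i).
    by exists [::] => s _ _; rewrite big1 ?mulf_1 // => i _; rewrite /F !mulf_1.
  - move=> x y [Sx [sx Ex]] [Sy [sy Ey]]; split=> [i|].
      by rewrite gmulfM; case: (SE i) => _ SM _; apply: SM.
    exists (sx ++ sy) => s us ss; rewrite gmulfM (Ex s) ?(Ey s) //; last first.
    + by move=> i ix; apply: ss; rewrite mem_cat ix.
    + by move=> i iy; apply: ss; rewrite mem_cat iy orbT.
    elim: s us {ss} => [|i s IH] /=; first by rewrite !big_nil mulg1.
    move=> /andP[is_ us]; rewrite !big_cons -IH // /F !gmulfM -!mulgA.
    congr (_ * _).
    rewrite !mulgA; congr (_ * _); apply: commute_sym.
    rewrite big_seq; apply: commute_prod => j js; apply: S_commute => //.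
    by apply: contraNneq is_ => ->.
  - move=> x [Sx [sx Ex]].
    have SxV i : S i (free_prod_proj i x^-1).
      by rewrite mulf_V; case: (SE i) => _ _ SV; apply: SV.
    split=> //; exists sx => s us ss; rewrite mulf_V (Ex s us ss).
    elim: s us {ss} => [|i s IH] /=; first by rewrite !big_nil invg1.
    move=> /andP[is_ us]; rewrite !big_cons invgM IH //.
    have -> : (F x i)^-1 = F x^-1 i by rewrite /F !mulf_V.
    apply: commute_sym; rewrite big_seq; apply: commute_prod => j js.
    by apply: S_commute => //; apply: contraNneq is_ => ->.
move=> _ [i _ [x Sx <-]]; split=> [j|].
  have [->|ij] := eqVneq j i; first by rewrite free_prod_proj_id.
  by rewrite free_prod_proj_neq 1?eq_sym //; case: (SE j).
exists [:: i] => s us /(_ i (mem_head _ _)) is_.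
have F1 r : i \notin r -> \prod_(j <- r) F (free_prod_in i x) j = 1.
  move=> ir; rewrite big1_seq // => j /andP[_ jr].
  rewrite /F free_prod_proj_neq ?mulf_1 //.
  by apply: contraNneq ir => ->.
case/splitPr: is_ us => u v; rewrite cat_uniq /= => /and4P[_].
rewrite negb_or => /andP[iu _] iv _.
by rewrite big_cat big_cons !F1 //= mul1g mulg1 /F free_prod_proj_id.
Qed.

Lemma prod_free_prod_proj_uniq z : gen (\bigcup_i (free_prod_in i @` S i)) z ->
  exists s, q z = \prod_(i <- s) F z i.
Proof.
move=> /prod_free_prod_proj[_ [s0 Es]]; exists (undup s0); apply: Es.
  exact: undup_uniq.
by move=> i; rewrite mem_undup.
Qed.
End ProductFormula.
End FreeProductTheory.

(** * Factoring through epimorphisms; cross commutators *)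

Section Factorization.
Variables (P E Q : groupType).
Variables (g : {multiplicative P -> E}) (h : {multiplicative P -> Q}).
Variables (s : E -> P) (sK : forall e, g (s e) = e).
Hypothesis gh : kernel g `<=` kernel h.

Lemma factor_eq x y : g x = g y -> h x = h y.
Proof.
move=> gxy; apply/eqP; rewrite -eqg_inv -mulg_eq1 -mulf_V -gmulfM.
by apply/eqP/gh; rewrite /kernel /= gmulfM mulf_V gxy mulVg.
Qed.

(** [s] is only a set-theoretic section; the two proofs are carried in the term because
    multiplicativity of [h \o s] rests on them. *)
Definition factor (_ : forall e, g (s e) = e) (_ : kernel g `<=` kernel h) :
  E -> Q := h \o s.

Lemma factorM : {morph factor sK gh : x y / x * y}.
Proof.
by move=> x y; rewrite -gmulfM; apply: factor_eq; rewrite gmulfM !sK.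
Qed.

HB.instance Definition _ := isMultiplicative.Build E Q (factor sK gh) factorM.

Lemma factorE x : factor sK gh (g x) = h x.
Proof. exact/factor_eq/sK. Qed.
End Factorization.

Lemma range_section (P E : Type) (g : P -> E) : range g = setT ->
  exists s, forall e, g (s e) = e.
Proof.
move=> g_surj; have /choice[s sK] e : exists x, g x = e; last by exists s.
have : range g e by rewrite g_surj.
by move=> [x _ <-]; exists x.
Qed.

Lemma factor_exists (P E Q : groupType) (g : {multiplicative P -> E})
    (h : {multiplicative P -> Q}) :
  range g = setT -> kernel g `<=` kernel h ->
  exists k : {multiplicative E -> Q}, forall x, k (g x) = h x.
Proof.
move=> /range_section[s sK] gh.
by exists (factor sK gh) => x; exact: factorE.
Qed.

Lemma normal_mem_commutator (G : groupType) (K : set G) :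
  is_normal K -> commutator K setT `<=` K.
Proof.
move=> [[K1 KM KV] KJ]; apply: gen_min => // _ [x [y [Kx _ ->]]].
by apply: KM; [exact: KV|exact: KJ].
Qed.

Lemma commutator_sub_derived (G : groupType) (S K : set G) :
  commutator S K `<=` derived G.
Proof.
apply: gen_min; first exact: derived_subgroup.
by move=> _ [x [y [_ _ ->]]]; apply: commutator_comm.
Qed.

Section CrossCommutators.
Variables (I : choiceType) (L : I -> groupType) (S : forall i, set (L i)).
Arguments S : clear implicits.

Lemma cross_commutators_comm i j x y : i != j -> S i x ->
  cross_commutators S [~ free_prod_in i x, free_prod_in j y].
Proof.
move=> ij Sx; apply: sub_gen; exists (i, j) => //; apply: sub_nclosure.
by apply: commutator_comm; [exists x|exists y].
Qed.

Lemma cross_commutators_min (K : set (free_prod L)) : is_normal K ->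
  (forall i j x y, i != j -> S i x ->
    K [~ free_prod_in i x, free_prod_in j y]) ->
  cross_commutators S `<=` K.
Proof.
move=> nK SK; have [sgK _] := nK.
apply: gen_min => // z [[i j] /= ij]; move: z; apply: nclosure_min => //.
apply: gen_min => // _ [_ [_ [[x Sx <-] [y _ <-] ->]]]; exact: SK.
Qed.

Lemma cross_commutators_derived :
  cross_commutators S `<=` derived (free_prod L).
Proof.
apply: cross_commutators_min => *; first exact: commutatorT_normal.
exact: commutator_comm.
Qed.
End CrossCommutators.

Lemma free_prod_map_in (I : choiceType) (L A : I -> groupType)
    (nu : forall i, {multiplicative L i -> A i}) i (x : L i) :
  free_prod_map nu (free_prod_in i x) = free_prod_in i (nu i x).
Proof. by rewrite /free_prod_map free_prod_lift_in. Qed.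

Lemma free_prod_map_surj (I : choiceType) (L A : I -> groupType)
    (nu : forall i, {multiplicative L i -> A i}) :
  (forall i, range (nu i) = setT) -> range (free_prod_map nu) = setT.
Proof.
move=> nu_surj; apply/seteqP; split=> // z _; move: z.
apply: free_prod_ind; first by apply: image_subgroup.
move=> i a; have : range (nu i) a by rewrite nu_surj.
by move=> [x _ <-]; exists (free_prod_in i x); rewrite ?free_prod_map_in.
Qed.

Lemma central_lift_derived (P E : groupType) (g h : {multiplicative P -> E}) :
  (forall x, center E ((h x)^-1 * g x)) -> forall x, derived P x -> g x = h x.
Proof.
move=> ghZ; apply: gen_min; first exact: equalizer_subgroup.
move=> _ [x [y [_ _ ->]]] /=; rewrite !mulf_R.
by rewrite -{1}(mulVKg (h x) (g x)) -{1}(mulVKg (h y) (g y)) commg_mul_center.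
Qed.

(** * Covers of regular products *)

Section RegularProduct.
Variables (I : choiceType) (G : groupType) (A : I -> subgroup G).
Hypothesis A_finite : forall i, finite_set (A i).
Hypothesis G_regular : regular_product A.
Variables (L : I -> groupType) (M : forall i, set (L i)).
Arguments M : clear implicits.
Variable nu : forall i, {multiplicative L i -> subgroup_type (A i)}.
Hypothesis L_exact : forall i, exact_sequence (M i) (nu i).
Hypothesis M_central : forall i, M i `<=` center (L i) `&` derived (L i).
Hypothesis M_multiplier : forall i,
  isog (M i) (schur_multiplier (subgroup_type (A i))).

(* [theta] is the composition of [nu : L -> A] and [psi : A -> G]. *)
Variable theta : {multiplicative free_prod L -> G}.
Hypothesis theta_in : forall i x, theta (free_prod_in i x) = val (nu i x).

Let J := kernel theta `&` cartesian_subgroup L.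
Let N := cross_commutatorsN M.
Let Mtot := gen (\bigcup_i (free_prod_in i @` M i) `|` J).
Let K := mulN N (commutatorTN J).

Let kernelM i : kernel (nu i) = M i.
Proof. by case: (L_exact i). Qed.

Let nuM i x : M i x -> nu i x = 1.
Proof. by rewrite -kernelM. Qed.

(** Let C be generated by the A_j^G with j != i. Modulo C, [theta z] equals the image of the i-th
    component of [z], as is seen on generators. If [theta z] is 1, that image lies in A_i and in C,
    so regularity makes it trivial. *)
Lemma regular_product_proj z i :
  kernel theta z -> M i (free_prod_proj i z).
Proof.
move=> thz; rewrite -kernelM /kernel /=.
have [_ /(_ i) reg] := G_regular.
have nC := @gen_bigcup_normal G I [set j | j != i] (fun j => nclosure (A j))
  (fun j _ => nclosure_normal _).
pose C := NormalSubgroup nC.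
have : coset C (theta z) = coset C (val (nu i (free_prod_proj i z))).
  move: z {thz}; apply: (free_prod_ext (f := coset C \o theta)
    (g := coset C \o subgroup_incl (A i) \o nu i \o free_prod_proj i)) => j x.
  rewrite /= theta_in; move: x; have [->|ji] := eqVneq j i => x.
    by rewrite free_prod_proj_id.
  rewrite free_prod_proj_neq // !mulf_1; apply/(coset_eq1 C).
  apply: sub_gen; exists j => //; apply: sub_nclosure.
  exact: set_mem (valP (nu j x)).
rewrite (thz : theta z = 1) mulf_1 => /esym/coset_eq1 Cz.
have : [set 1] (val (nu i (free_prod_proj i z))).
  by rewrite -reg; split=> //; exact: set_mem (valP (nu i _)).
move=> v1; apply: val_inj.
by rewrite [LHS]v1 [RHS](mulf_1 (subgroup_incl (A i))).
Qed.

Let J_kernel z : J z -> kernel theta z. Proof. by case. Qed.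

Let N_kernel : cross_commutators M `<=` kernel theta.
Proof.
apply: cross_commutators_min; first exact: kernel_normal.
move=> i j x y _ Mx; rewrite /kernel /= mulf_R.
by rewrite [theta (free_prod_in i x)]theta_in nuM // mulf_1 comm1g.
Qed.

Let K_kernel : K `<=` kernel theta.
Proof.
have [[_ KM _] _] := kernel_normal theta.
move=> _ [x [y [Nx Jy ->]]]; apply: KM; first exact: N_kernel.
apply: (normal_mem_commutator (kernel_normal theta)).
move: Jy; apply: gen_min; first exact: gen_subgroup.
by move=> _ [a [b [/J_kernel ? _ ->]]]; apply: commutator_comm.
Qed.

(** Modulo the cartesian subgroup [Q] the factors commute, so [z] is congruent to the product [m] of
    its components. These lie in the M_i by regularity, and the remainder m^-1 z lies in J. *)
Let kernel_theta : kernel theta = Mtot.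
Proof.
have [sgk nk] := kernel_normal theta.
apply/seteqP; split=> z; last first.
  move: z; apply: gen_min => // z [[i _ [x Mx <-]]|/J_kernel//].
  by rewrite /kernel /= theta_in nuM.
move=> thz; have Mz i := regular_product_proj i thz.
have [gen1 mulM _] := gen_subgroup (\bigcup_i (free_prod_in i @` M i) `|` J).
pose Q := cross_commutatorsN (fun i => [set: L i]).
have [s Es] : exists s, coset Q z =
    \prod_(i <- s) coset Q (free_prod_in i (free_prod_proj i z)).
  apply: (@prod_free_prod_proj_uniq _ _ _ (coset Q) (fun i => setT)) => //.
    move=> i j x y ij _ _; apply/commgP/eqP; rewrite -mulf_R.
    apply/(coset_eq1 Q); exact: cross_commutators_comm.
  move: z {thz Mz}; apply: free_prod_ind; first exact: gen_subgroup.
  by move=> i x; apply: sub_gen; exists i => //; exists x.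
pose m := \prod_(i <- s) free_prod_in i (free_prod_proj i z).
have qm : coset Q m = coset Q z.
  by rewrite Es /m mulf_prod.
have Mm : Mtot m.
  apply: big_ind => // i _.
  by apply: sub_gen; left; exists i => //; exists (free_prod_proj i z).
have -> : z = m * (m^-1 * z) by rewrite mulVKg.
apply: mulM => //; apply: sub_gen; right; split.
  have [k1 kM kV] := sgk; apply: (kM) => //; apply: kV.
  apply: big_ind => // i _.
  by rewrite /kernel /= theta_in nuM.
exact/(cosetP Q).
Qed.

Definition regular_cover_map : quotient K -> G := quotient_lift K_kernel.
HB.instance Definition _ := Multiplicative.on regular_cover_map.

Lemma kernel_regular_cover_map : kernel regular_cover_map = coset K @` Mtot.
Proof.
rewrite -kernel_theta; apply/seteqP; split=> [q|_ [x thx <-]].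
  rewrite -(coset_repr q) /kernel /= /regular_cover_map quotient_lift_coset.
  by exists (repr q).
by rewrite /kernel /= /regular_cover_map quotient_lift_coset.
Qed.

Let theta_surj : range theta = setT.
Proof.
have [genA _] := G_regular; rewrite -subTset -genA.
apply: gen_min; first exact/image_subgroup.
move=> a [i _ Aa]; have [_ nu_surj] := L_exact i.
have : range (nu i) (Sub a (mem_set Aa)) by rewrite nu_surj.
by move=> [x _ nx]; exists (free_prod_in i x); rewrite // theta_in nx.
Qed.

Lemma regular_cover_map_surj : range regular_cover_map = setT.
Proof.
rewrite -subTset -theta_surj => _ [x _ <-]; exists (coset K x) => //.
by rewrite /regular_cover_map quotient_lift_coset.
Qed.

Let Mtot_min (C : set (quotient K)) : is_subgroup C ->
  (forall i x, M i x -> C (coset K (free_prod_in i x))) ->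
  (forall x, J x -> C (coset K x)) -> coset K @` Mtot `<=` C.
Proof.
move=> sgC CM CJ _ [x Mx <-]; move: x Mx; apply: image_gen => //.
by move=> x [[i _ [y My <-]]|Jx]; [exact: CM|exact: CJ].
Qed.

(** An M_i commutes with L_i by assumption and with the other L_j modulo N, while J becomes central
    modulo [J, L]. *)
Lemma regular_cover_central : kernel regular_cover_map `<=` center (quotient K).
Proof.
have [[N1 _ _] _] := normal_setP N.
have [[J1 _ _] _] := commutatorT_normal J.
rewrite kernel_regular_cover_map; apply: Mtot_min; first exact: center_subgroup.
  move=> i x Mx q; rewrite -(coset_repr q).
  move: (repr q); apply: free_prod_ind.
    split=> [|y z /= Cy Cz|y /= Cy].
      by rewrite /= mulf_1; exact: commute1.
      by rewrite gmulfM; exact: commuteM.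
    by rewrite mulf_V; exact: commuteV.
  move=> j y /=; apply/commgP/eqP; rewrite -mulf_R.
  move: y; have [->|ij] := eqVneq j i => y.
    rewrite -mulf_R (_ : [~ x, y] = 1) ?mulf_1 //; apply/eqP/commgP.
    by have [Zx _] := M_central Mx.
  apply/(coset_eq1 K); exists [~ free_prod_in i x, free_prod_in j y], 1.
  rewrite mulg1; split=> //; apply: cross_commutators_comm => //.
  by rewrite eq_sym.
move=> x Jx q; rewrite -(coset_repr q); apply/commgP/eqP; rewrite -mulf_R.
apply/(coset_eq1 K); exists 1, [~ x, repr q]; rewrite mul1g; split=> //.
exact: commutator_comm.
Qed.

Lemma regular_cover_derived :
  kernel regular_cover_map `<=` derived (quotient K).
Proof.
rewrite kernel_regular_cover_map.
apply: Mtot_min; first exact: derived_subgroup.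
  move=> i x Mx; apply: image_derived; apply: image_derived.
  by have [_ Dx] := M_central Mx.
move=> x [_ Cx]; apply: image_derived; exact: cross_commutators_derived Cx.
Qed.

Let F i : groupType := free_group (subgroup_type (A i)).
Let P : groupType := free_prod F.

Lemma presentation_lift i : exists g : {multiplicative F i -> L i},
  forall x, nu i (g x) = presentation x.
Proof.
have [_ /range_section[s sK]] := L_exact i.
exists (free_lift s).
apply: (free_group_ext (f := nu i \o free_lift s)) => t /=.
by rewrite free_lift_gen sK; apply/esym/free_lift_gen.
Qed.

(** * The presentation of G by the free product of the F_i *)

Section FreeCover.
Variable gamma : forall i, {multiplicative F i -> L i}.
Hypothesis nu_gamma : forall i x, nu i (gamma i x) = presentation x.
Let gammaL : {multiplicative P -> free_prod L} := free_prod_map gamma.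
Let RP : set P := kernel (theta \o gammaL).
Let commRP : normal_subgroup P := commutatorTN RP.
Let T i : set (F i) := kernel (gamma i).
Arguments T : clear implicits.
Let genT : set P := gen (\bigcup_i (free_prod_in i @` T i)).

Let fZ i : kernel (nu i) `<=` center (L i).
Proof. by rewrite kernelM => x /M_central[]. Qed.

Let fD i : kernel (nu i) `<=` derived (L i).
Proof. by rewrite kernelM => x /M_central[]. Qed.

Let gamma_surj i : range (gamma i) = setT.
Proof.
exact: stem_lift_surj (@fZ i) (@fD i) (nu_gamma (i := i))
  (@presentation_surj _).
Qed.

Let gammaL_surj : range gammaL = setT.
Proof. exact: free_prod_map_surj. Qed.

Let gammaL_in i x : gammaL (free_prod_in i x) = free_prod_in i (gamma i x).
Proof. exact: free_prod_map_in. Qed.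

Let RP_in i x : kernel (@presentation _) x -> RP (free_prod_in i x).
Proof.
move=> px; rewrite /RP /kernel /= gammaL_in theta_in nu_gamma.
by rewrite [presentation x]px.
Qed.

(** Here the finiteness of A_i and the isomorphism of M_i with the full multiplier of A_i enter. *)
Let gamma_inj i x : T i x -> derived (F i) x ->
  commutator (kernel (@presentation _)) setT x.
Proof.
move=> Tx Dx.
apply: (stem_lift_inj (@fZ i) (@fD i) (nu_gamma (i := i))) => //.
(* [insubd 1] maps the finite set [A i] onto the subtype; its default value is taken only outside
   [A i]. *)
- apply: sub_finite_set (finite_image (insubd 1) (A_finite i)) => a _.
  by exists (val a); [exact: set_mem (valP a)|exact: valKd].
- by rewrite kernelM; exact: M_multiplier.
- by rewrite /kernel /= -nu_gamma [gamma i x]Tx mulf_1.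
Qed.

Let genT_RP : genT `<=` RP.
Proof.
apply: gen_min; first by case: (kernel_normal (theta \o gammaL)).
move=> _ [i _ [x Tx <-]]; apply: RP_in.
by rewrite /kernel /= -nu_gamma [gamma i x]Tx mulf_1.
Qed.

Let q0_central x : RP x -> center (quotient commRP) (coset commRP x).
Proof.
move=> Rx q; rewrite -(coset_repr q); apply/commgP/eqP; rewrite -mulf_R.
by apply/(coset_eq1 commRP); apply: commutator_comm.
Qed.

(** The T_i are central modulo [RP, P], so [y] is there the product of its components. Each lies in
    T_i and in F_i', hence in [R_i, F_i], which maps into [RP, P]. *)
Let genT_derived y : genT y -> derived P y -> coset commRP y = 1.
Proof.
move=> Ty Dy.
have Tsg i : is_subgroup (T i) by case: (kernel_normal (gamma i)).
have Tcomm i j (x : F i) (z : F j) : i != j -> T i x -> T j z ->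
    commute (coset commRP (free_prod_in i x)) (coset commRP (free_prod_in j z)).
  move=> _ Tx _; apply: q0_central; apply: genT_RP; apply: sub_gen.
  by exists i => //; exists x.
have [Tpi _] := prod_free_prod_proj Tsg Tcomm Ty.
have [s ->] := prod_free_prod_proj_uniq Tsg Tcomm Ty.
apply: big1_seq => i _; apply/(coset_eq1 commRP).
have : commutator (kernel (@presentation _)) setT (free_prod_proj i y).
  apply: gamma_inj; first exact: Tpi.
  exact: (image_derived (free_prod_proj i)).
move: (free_prod_proj i y); apply: image_gen; first exact: gen_subgroup.
move=> _ [a [b [Ra _ ->]]]; rewrite mulf_R; apply: commutator_comm => //.
exact: RP_in.
Qed.

(** The quotient by [RP, P]T is formed in two steps: the image of T is normal in P/[RP, P] because
    it is central there. *)
Let U_normal : is_normal (coset commRP @` genT).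
Proof.
apply: center_fix_normal; first exact/image_subgroup/gen_subgroup.
by move=> _ [x Tx <-]; apply: q0_central; apply: genT_RP.
Qed.
Let U := NormalSubgroup U_normal.
Let q1 : {multiplicative P -> quotient U} := coset U \o coset commRP.

Lemma free_cover_inj y : derived P y -> normal_set K (gammaL y) ->
  commutator RP setT y.
Proof.
have [lam lamE] : exists lam : {multiplicative free_prod L -> quotient U},
    forall x, lam (gammaL x) = q1 x.
  apply: factor_exists => // x.
  (* [q1] kills each T_i, so it descends to every L_i. The universal property glues these maps into
     one on [free_prod L], which shows that the kernel of [gammaL] dies under [q1]. *)
  have ex i : exists l : {multiplicative L i -> quotient U},
      forall x, l (gamma i x) = q1 (free_prod_in i x).
    apply: (@factor_exists _ _ _ (gamma i) (q1 \o free_prod_in i)) => // z Tz.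
    apply/(coset_eq1 U); exists (free_prod_in i z) => //; apply: sub_gen.
    by exists i => //; exists z.
  pose l i := sval (cid (ex i)).
  have lE i z : l i (gamma i z) = q1 (free_prod_in i z) := svalP (cid (ex i)) z.
  suff : free_prod_lift l (gammaL x) = q1 x.
    by move=> lx gx; rewrite /kernel /= -[LHS]lx [gammaL x]gx mulf_1.
  move: x; apply: (free_prod_ext (f := free_prod_lift l \o gammaL)) => i z.
  by rewrite /= gammaL_in free_prod_lift_in lE.
have lam_central z : kernel theta z -> center (quotient U) (lam z).
  have : range gammaL z by rewrite gammaL_surj.
  move=> [x _ <-] Rx q; rewrite lamE -(coset_repr q).
  exact: (@gmulf_commute _ _ (coset U) _ _ (@q0_central x Rx (repr q))).
have K_lam : K `<=` kernel lam.
  have [[_ kM _] _] := kernel_normal lam.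
  move=> _ [a [b [Na Jb ->]]]; apply: kM; last first.
    by move: Jb; apply: commutator_kernel => r /J_kernel; exact: lam_central.
  move: Na; apply: cross_commutators_min; first exact: kernel_normal.
  move=> i j x z _ Mx; rewrite /kernel /= mulf_R; apply/eqP/commgP.
  by apply: lam_central; rewrite /kernel /= theta_in nuM.
move=> Dy /K_lam; rewrite /kernel /= lamE => /(coset_eq1 U)[t Tt ty].
apply/(coset_eq1 commRP); rewrite -ty; apply: genT_derived => //.
(* [t] and [y] differ by an element of [RP, P], which lies in P', so [t] inherits membership in P'
   from [y]. *)
have [_ DM DV] := derived_subgroup P.
have /cosetP ty' := ty.
have -> : t = y * (t^-1 * y)^-1 by rewrite invgM invgK mulVKg.
apply: DM => //; apply: DV; exact: commutator_sub_derived ty'.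
Qed.

(* [beta \o alpha] is the identity modulo the kernel of the canonical
   presentation, hence, on the derived subgroup, modulo the commutators of that
   kernel: this transfers [free_cover_inj] to the canonical presentation. *)
Lemma regular_cover_isog :
  isog (kernel regular_cover_map) (schur_multiplier G).
Proof.
have p_surj : range (theta \o gammaL) = setT.
  rewrite -subTset -theta_surj => _ [z _ <-].
  have : range gammaL z by rewrite gammaL_surj.
  by move=> [x _ <-]; exists x.
have [r rK] := range_section p_surj.
have [alpha theta_alpha] : exists alpha : {multiplicative free_group G -> P},
    forall x, theta (gammaL (alpha x)) = presentation x.
  exists (free_lift r).
  apply: (free_group_ext (f := theta \o gammaL \o free_lift r)) => t /=.
  by rewrite free_lift_gen [LHS]rK; apply/esym/free_lift_gen.
have [beta pres_beta] : exists beta : {multiplicative P -> free_group G},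
    forall y, presentation (beta y) = theta (gammaL y).
  (* The generator of F_i at an element of A_i goes to the generator of the free group on G at the
     same element. *)
  pose b i := free_lift (fun a : subgroup_type (A i) => free_gen (val a)).
  exists (free_prod_lift b).
  apply: (free_prod_ext (f := @presentation G \o free_prod_lift b)
    (g := theta \o gammaL)) => i x /=.
  rewrite gammaL_in theta_in nu_gamma free_prod_lift_in /=.
  move: x; apply: (free_group_ext (f := @presentation G \o b i)
    (g := subgroup_incl (A i) \o @presentation _)) => t /=.
  rewrite free_lift_gen [LHS]free_lift_gen.
  by congr val; apply/esym/free_lift_gen.
apply: (@isog_schur_multiplier _ _ _ (coset K \o gammaL \o alpha)).
- exact: regular_cover_central.
- exact: regular_cover_derived.
- by move=> x /=; rewrite /regular_cover_map quotient_lift_coset theta_alpha.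
move=> x Rx Dx /= /(coset_eq1 K) Kx.
have /(free_cover_inj (image_derived alpha Dx)) {}Kx := Kx.
pose c := coset (commutatorTN (kernel (@presentation G))).
have c_central y : kernel (@presentation G) y -> center _ (c y).
  move=> Ry q; rewrite -(coset_repr q); apply/commgP/eqP; rewrite -mulf_R.
  by apply/(coset_eq1 (commutatorTN _)); apply: commutator_comm.
apply/(coset_eq1 (commutatorTN (kernel (@presentation G)))).
rewrite -(@central_lift_derived _ _ (c \o beta \o alpha) c) //; last first.
  move=> y /=; rewrite -mulf_V -gmulfM; apply: c_central.
  rewrite /kernel /= gmulfM mulf_V.
  rewrite [X in _ * X]pres_beta [X in _ * X]theta_alpha.
  exact: mulVg.
apply/(coset_eq1 (commutatorTN _)).
(* [alpha x] lies in [RP, P], and [beta] maps RP into the kernel of the canonical presentation. *)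
move: Kx; apply: image_gen; first exact: gen_subgroup.
move=> _ [a [b [Ra _ ->]]]; rewrite mulf_R; apply: commutator_comm => //.
by rewrite /kernel /= pres_beta.
Qed.
End FreeCover.

Lemma regular_cover_multiplier :
  isog (coset K @` Mtot) (schur_multiplier G).
Proof.
rewrite -kernel_regular_cover_map.
pose gamma i := sval (cid (presentation_lift i)).
have gammaE i x : nu i (gamma i x) = presentation x :=
  svalP (cid (presentation_lift i)) x.
exact: regular_cover_isog gammaE.
Qed.
End RegularProduct.

Lemma quotient_kernel_isog (Y X : groupType) (f : {multiplicative Y -> X})
    (B : normal_subgroup Y) : kernel f = B -> range f = setT ->
  isog [set: quotient B] [set: X].
Proof.
move=> fB f_surj; have Bf : B `<=` kernel f by rewrite fB.
exists (quotient_lift Bf); split; last by move=> x y _ _; exact: gmulfM.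
split=> // [p q _ _|x _].
  rewrite -(coset_repr p) -(coset_repr q) !quotient_lift_coset => fpq.
  apply/cosetP; rewrite -fB /kernel /= gmulfM mulf_V fpq mulVg //.
have : range f x by rewrite f_surj.
by move=> [y _ <-]; exists (coset B y); rewrite ?quotient_lift_coset.
Qed.

Theorem corollary4p5 (disp : Order.disp_t) (I : porderType disp)
    (G : groupType) (A : I -> subgroup G)
    (A_finite : forall i, finite_set (A i))
    (G_regular : regular_product A)
    (L : I -> groupType) (M : forall i, set (L i))
    (nu : forall i, {multiplicative L i -> subgroup_type (A i)})
    (M_normal : forall i, is_normal (M i))
    (L_exact : forall i, exact_sequence (M i) (nu i))
    (M_central : forall i, M i `<=` center (L i) `&` derived (L i))
    (M_multiplier : forall i,
       isog (M i) (schur_multiplier (subgroup_type (A i)))) :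
  let psi := free_prod_lift (fun i : I => subgroup_incl (A i)) in
  let H := kernel psi in
  let J := free_prod_map nu @^-1` H `&` cartesian_subgroup L in
  let N := cross_commutatorsN M in
  let Mtot := gen (\bigcup_i (free_prod_in i @` M i) `|` J) in
  let K := mulN N (commutatorTN J) in
  let Lbar : groupType := quotient K in
  let Mbar : set Lbar := coset K @` Mtot in
  (exists phi : {multiplicative Lbar -> G},
     [/\ exact_sequence Mbar phi,
         Mbar `<=` center Lbar `&` derived Lbar
       & isog Mbar (schur_multiplier G)])
  /\ is_covering_group Lbar G.
Proof.
move=> psi H J N Mtot K Lbar Mbar.
have theta_in i x :
    (psi \o free_prod_map nu) (free_prod_in i x) = val (nu i x).
  by rewrite /= free_prod_map_in /psi free_prod_lift_in.
pose phi : {multiplicative Lbar -> G} :=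
  regular_cover_map (M := M) L_exact (theta := psi \o free_prod_map nu)
    theta_in.
have kphi : kernel phi = Mbar.
  exact: (kernel_regular_cover_map G_regular L_exact theta_in).
have phi_surj : range phi = setT.
  exact: (regular_cover_map_surj G_regular L_exact theta_in).
have MbarZD : Mbar `<=` center Lbar `&` derived Lbar.
  rewrite -kphi => x phx; split.
    exact: (regular_cover_central G_regular M_central phx).
  exact: (regular_cover_derived G_regular M_central phx).
have Mbar_multiplier : isog Mbar (schur_multiplier G).
  exact: (regular_cover_multiplier A_finite G_regular L_exact M_central
    M_multiplier theta_in).
split; first by exists phi; split.
have Mbar_normal : is_normal Mbar by rewrite -kphi; exact: kernel_normal.
exists (NormalSubgroup Mbar_normal); split=> //.
exact: quotient_kernel_isog phi_surj.
Qed.
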